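(* (i) Let $f$ be a continuous surjective self-map of a compact metric space $X$. If $h(f)>0$, then $h_{A}(f)>0$, and thus $h_{A}(\hat f)=+\infty$, for any $A\in\mathcal{S}$. (ii) There exists a sequence $f_{0,\infty}=\{f_n\}_{n=0}^\infty$ of continuous self-maps of $X=[0,1]$ with $h(f_{0,\infty})>0$ but $h_{A}(f_{0,\infty})=h_{A}(\hat f_{0,\infty})=0$ for some $A\in\mathcal{S}$.
   Context: $f_0^n=f_{n-1}\circ\cdots\circ f_0$, $f_0^0=\mathrm{id}$; for a single map $f$ the sequence is constant $f_n=f$. $\mathcal S$ is the set of strictly increasing sequences $A=\{a_i\}_{i\ge1}$ of nonnegative integers. For a compact metric space $Z$ and continuous self-maps $g_{0,\infty}$, $h_A(g_{0,\infty})=\sup_{\mathscr A}\limsup_{n\to\infty}\frac1n\log\mathcal N(\bigvee_{i=1}^n (g_0^{a_i})^{-1}\mathscr A)$ over finite open covers ($\bigvee$ = common refinement, $\mathcal N$ = minimal cardinality of a subcover); the topological entropy is $h(g_{0,\infty})=h_A(g_{0,\infty})$ with $A=\{0,1,2,\dots\}$. $\mathcal M(X)$ is the space of Borel probability measures on $X$ with the weak$^*$ topology (compact metric, e.g. via the Prohorov metric), and $\hat f_n(\mu)(B)=\mu(f_n^{-1}(B))$. *)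

(* Defs.v *)
From HB Require Import structures.
From mathcomp Require Import all_boot all_order all_algebra.
From mathcomp Require Import all_classical all_reals all_analysis.
Set Implicit Arguments. Unset Strict Implicit. Unset Printing Implicit Defensive.
Import Order.TTheory GRing.Theory Num.Theory.
Import numFieldNormedType.Exports.
Local Open Scope classical_set_scope.
Local Open Scope ring_scope.

Fixpoint comp_seq (S : Type) (g : nat -> S -> S) (k : nat) : S -> S :=
  match k with
  | 0 => id
  | k.+1 => g k \o comp_seq g k
  end.

(* A sequence A = {a_1 < a_2 < ...} of nonnegative integers is encoded by a
   strictly increasing a : nat -> nat with a i = a_{i+1}. *)
Definition strict_incr (a : nat -> nat) : Prop := forall m n, (m < n)%N -> (a m < a n)%N.

Section Entropy.
Variable R : realType.
Variable S : Type.
(* the space: a subset Y of the carrier S, together with the predicate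
   "open subset of Y" (relative topology). *)
Variable Y : set S.
Variable opn : set S -> Prop.

Definition open_cover (m : nat) (C : nat -> set S) : Prop :=
  (forall j, (j < m)%N -> opn (C j)) /\
  Y `<=` [set x | exists2 j, (j < m)%N & C j x].

(* k members of the common refinement \/_{i=1}^n (g_0^{a_i})^{-1} C cover Y;
   a member of the refinement is  /\_{i<n} (g_0^{a_i})^{-1} (C (s i)). *)
Definition join_covered_by (g : nat -> S -> S) (a : nat -> nat)
    (m : nat) (C : nat -> set S) (n k : nat) : Prop :=
  exists sigma : nat -> nat -> nat,
    (forall j i, (j < k)%N -> (i < n)%N -> (sigma j i < m)%N) /\
    Y `<=` [set x | exists2 j, (j < k)%N &
                      forall i, (i < n)%N -> C (sigma j i) (comp_seq g (a i) x)].

Definition Njoin (g : nat -> S -> S) (a : nat -> nat)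
    (m : nat) (C : nat -> set S) (n : nat) : nat :=
  xget 0%N [set k | join_covered_by g a m C n k /\
                    forall k', join_covered_by g a m C n k' -> (k <= k')%N].

Definition entropyA (g : nat -> S -> S) (a : nat -> nat) : \bar R :=
  ereal_sup [set l | exists m C, open_cover m C /\
     l = limn_esup (fun n => ((ln (Njoin g a m C n)%:R) / n%:R)%:E)].

End Entropy.

(* The phase space X is a compact subset K of a topological space T,      *)
(* with the relative topology.                                            *)
Definition rel_open (T : topologicalType) (K : set T) (U : set T) : Prop :=
  exists2 V : set T, open V & U = K `&` V.

Definition borel (T : ptopologicalType) := g_sigma_algebraType (@open T).

Section Measures.
Variable R : realType.
Variable T : ptopologicalType.
Variable K : set T.

(* M(K): Borel probability measures on K, represented as set functions on
   the Borel sets of T that are (the set function of) a probability measure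
   with full mass on K; they are normalised to 0 on non-Borel sets so that
   distinct elements of MK are distinct measures. *)
Definition MK : set (set (borel T) -> \bar R) :=
  [set nu | (exists P : probability (borel T) R,
               forall B, measurable B -> P B = nu B) /\
            (forall B, ~ measurable B -> nu B = 0%E) /\
            nu K = 1%E].

Definition weak_open (U : set (set (borel T) -> \bar R)) : Prop :=
  U `<=` MK /\
  forall nu, U nu ->
    exists (k : nat) (gs : nat -> T -> R) (e : R),
      0 < e /\ (forall i, (i < k)%N -> {within K, continuous (gs i)}) /\
      forall nu', MK nu' ->
        (forall (P P' : probability (borel T) R),
            (forall B, measurable B -> P B = nu B) ->
            (forall B, measurable B -> P' B = nu' B) ->
            forall i, (i < k)%N ->
              (`| \int[P']_(x in K) (gs i x)%:E - \int[P]_(x in K) (gs i x)%:E |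
                 < e%:E)%E) ->
        U nu'.

Definition push (f : T -> T) (nu : set (borel T) -> \bar R) :
    set (borel T) -> \bar R :=
  fun B => if `[< measurable B >] then nu (K `&` f @^-1` B) else 0%E.

End Measures.


Definition I01 (R : realType) : set R := `[0%R, 1%R].
Arguments I01 : clear implicits.

(* Main.v *)
Require Import Defs.
From HB Require Import structures.
From mathcomp Require Import all_boot all_order all_algebra.
From mathcomp Require Import zify ring lra.
From mathcomp Require Import all_classical all_reals all_analysis measurable_realfun.
Import Order.TTheory GRing.Theory Num.Theory.
Import numFieldNormedType.Exports.
Local Open Scope classical_set_scope.
Local Open Scope ring_scope.
Set Implicit Arguments. Unset Strict Implicit. Unset Printing Implicit Defensive.

(** (i) Let A consist of the first n terms of the sequence and let M be the
    covering number of the refinement of a cover along A. A greedy choice of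
    about q N / n translates of A covers an interval of N consecutive times up
    to 2 N / q points, so the covering number along the interval is at most
    M^((q+1) N / n) m^(2 N / q), with m the size of the cover. If the left side
    is at least e^(h N) and q is large, then log M >= c n with c > 0
    independent of n. For the induced map, take continuous functions g_i
    subordinate to the cover such that every point has some g_i = 1. There are
    M points x_u any two of which are told apart by some g_i at some time of A.
    The measures proportional to sum_(l < k) 2^l delta_(x_(u_l)), for the M^k
    words u, are then told apart by the integrals of the g_i: at the largest l
    where two words differ the weight 2^l exceeds the sum of the smaller ones.
    Hence the sequence entropy of the induced map is at least k c for all k.

    (ii) Alternate x |-> x / (i + 1) with x |-> T ((i + 1) x), where T is a map
    with a full two-branched horseshoe. At even times the composition is an
    iterate of T, which gives positive entropy; at the odd time 2 i + 1 the
    image of [0, 1] is inside [0, 1 / (i + 1)], so that all orbits, and all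
    orbits of measures, end up in one member of any given open cover. *)

(** * Covering numbers of refinements *)

Section NjoinTheory.
Variables (S : Type) (Y : set S) (g : nat -> S -> S) (a : nat -> nat).
Variables (m : nat) (C : nat -> set S).

Lemma join_covered_by_exists n :
  Y `<=` [set x | exists2 j, (j < m)%N & C j x] ->
  (forall i x, Y x -> Y (comp_seq g (a i) x)) ->
  exists k, join_covered_by Y g a m C n k.
Proof.
move=> cov gY; pose F := {ffun 'I_n -> 'I_m}.
(* One member for each of the m^n words; outside the ranges j < m^n and i < n the value 0 is a mere
   default. *)
exists #|F|; exists (fun j i => if insub j is Some jj then
   if insub i is Some ii then enum_val (jj : 'I_#|F|) (ii : 'I_n) : nat else 0%N else 0%N).
split=> [j i jk il|x Yx].
  by rewrite (insubT (fun j => j < #|F|)%N jk) (insubT (fun i => i < n)%N il).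
have /choice[s sP] : forall i : 'I_n, exists j : 'I_m, C j (comp_seq g (a i) x).
  move=> i; have [j jm Cj] := cov _ (gY i x Yx).
  by exists (Ordinal jm).
exists (enum_rank (finfun s : F)) => [|i il]; first by rewrite ltn_ord.
by rewrite valK (insubT (fun i => i < n)%N il) enum_rankK ffunE; apply: sP.
Qed.

(** [Njoin] takes the default 0 only when no [k] is admissible; a nonempty set of naturals has a
    least element. *)
Lemma Njoin_min n : (exists k, join_covered_by Y g a m C n k) ->
  join_covered_by Y g a m C n (Njoin Y g a m C n) /\
  forall k, join_covered_by Y g a m C n k -> (Njoin Y g a m C n <= k)%N.
Proof.
move=> ex; rewrite /Njoin; case: xgetP => [k _ []//|none].
have exb : exists k, `[< join_covered_by Y g a m C n k >].
  by case: ex => k ?; exists k; apply/asboolP.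
case: (none (ex_minn exb)); case: ex_minnP => k /asboolP ck kmin; split => //.
by move=> k' ck'; apply/kmin/asboolP.
Qed.

Lemma Njoin_le n k : join_covered_by Y g a m C n k -> (Njoin Y g a m C n <= k)%N.
Proof. by move=> c; apply: (Njoin_min _).2 => //; exists k. Qed.

Lemma join_covered_by_gt0 n k : Y !=set0 -> join_covered_by Y g a m C n k -> (0 < k)%N.
Proof. by move=> [x Yx] [s [_ /(_ x Yx)[j]]]; case: k. Qed.

(** Pigeonhole: sending [u] to a member of the refinement that contains [p u] is injective, since
    two points of one member share an element of the cover at every time. *)
Lemma card_le_join_covered_by (I : finType) (p : I -> S) n k :
  (forall u, Y (p u)) ->
  (forall u v, u != v -> exists2 i, (i < n)%N & forall j, (j < m)%N ->
     ~ (C j (comp_seq g (a i) (p u)) /\ C j (comp_seq g (a i) (p v)))) ->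
  join_covered_by Y g a m C n k -> (#|I| <= k)%N.
Proof.
move=> pY sep [s [sm cov]].
have /choice[h hP] : forall u, exists j : 'I_k, forall i, (i < n)%N ->
    C (s j i) (comp_seq g (a i) (p u)).
  by move=> u; have [j jk Cj] := cov _ (pY u); exists (Ordinal jk).
rewrite -[leqRHS]card_ord; apply: (@leq_card _ _ h) => u v huv.
apply/eqP/negPn/negP => /sep[i il]; move/(_ (s (h u) i)); apply.
  exact: sm.
by split; [exact: hP|rewrite huv; exact: hP].
Qed.

(** From time [i0] on, the constant letter [j0] extends every word, so no new members are needed. *)
Lemma Njoin_tail_le i0 j0 n : (j0 < m)%N ->
  Y `<=` [set x | exists2 j, (j < m)%N & C j x] ->
  (forall i x, Y x -> Y (comp_seq g (a i) x)) ->
  (forall i x, (i0 <= i)%N -> Y x -> C j0 (comp_seq g (a i) x)) ->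
  (Njoin Y g a m C n <= Njoin Y g a m C i0)%N.
Proof.
move=> j0m cov gY tail.
have [[s [sm sc]] _] := Njoin_min (join_covered_by_exists i0 cov gY).
apply: Njoin_le; exists (fun j i => if (i < i0)%N then s j i else j0).
split=> [j i jk il|x Yx]; first by case: ifPn => // /sm; apply.
have [j jk Cj] := sc x Yx; exists j => // i il.
by case: ltnP => [/Cj//|ii]; exact: tail.
Qed.

End NjoinTheory.

(** * Bounds for upper limits *)

Section Elimsup.
Variable R : realType.
Local Open Scope ereal_scope.

Lemma limn_esup_le (u : (\bar R)^nat) l n0 :
  (forall n, (n0 <= n)%N -> u n <= l) -> limn_esup u <= l.
Proof.
move=> ul; rewrite limn_esup_lim; apply: lime_le; first exact: is_cvg_esups.
exists n0 => // n /= n0n; apply: ge_ereal_sup => _ [k /= nk <-].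
by apply: ul; apply: leq_trans nk.
Qed.

Lemma le_limn_esup (u : (\bar R)^nat) l n0 :
  (forall n, (n0 <= n)%N -> l <= u n) -> l <= limn_esup u.
Proof.
move=> lu; rewrite limn_esup_lim; apply: lime_ge; first exact: is_cvg_esups.
exists n0 => // n /= n0n; apply: (le_trans (lu _ n0n)); apply: ereal_sup_ubound.
by exists n => /=.
Qed.

End Elimsup.

(** * Covering an interval of integers by translates of a finite set *)

Section GreedyTranslates.
Local Open Scope nat_scope.
Variables (A : seq nat) (L N : nat).
Hypotheses (A_uniq : uniq A) (A_le : forall x, x \in A -> x <= L).

Let W := L + N.
Let translate t u := u \in map (addn t) A.

(** The translates t + A that contain u are those with t = u - x for x in A; the window starts at L
    so that u - x is never negative. *)
Let count_translates u : L <= u < W -> size A <= count (translate^~ u) (iota 0 W).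
Proof.
move=> /andP[Lu uW]; rewrite -size_filter.
rewrite -(size_map (fun x => u - x)); apply: uniq_leq_size.
  rewrite map_inj_in_uniq // => x y /A_le xL /A_le yL.
  by move/eqP; rewrite eqn_sub2lE ?(leq_trans _ Lu)// => /eqP.
move=> _ /mapP[x xA ->]; have xL := A_le xA.
rewrite mem_filter mem_iota /= add0n (leq_ltn_trans _ uW) ?leq_subr// andbT.
by apply/mapP; exists x => //; rewrite subnK// (leq_trans xL).
Qed.

(** Double counting of the pairs (t, u) with u in t + A. *)
Let sum_translates U : {subset U <= iota L N} ->
  size A * size U <= \sum_(t <- iota 0 W) count (translate t) U.
Proof.
elim: U => [|u U ih] sU; first by rewrite muln0.
rewrite mulnS /= big_split /=; apply: leq_add; last first.
  by apply: ih => x xU; apply: sU; rewrite inE xU orbT.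
have -> : \sum_(t <- iota 0 W) translate t u = count (translate^~ u) (iota 0 W).
  by rewrite -sum1_count [RHS]big_mkcond; apply: eq_bigr => t _; case: translate.
by apply: count_translates; have := sU u (mem_head _ _); rewrite mem_iota.
Qed.

(** Averaging over the W translates: one of them meets U in at least |A| |U| / W points.
    Denominators are cleared, and W = 0 forces U to be empty. *)
Let one_translate U : {subset U <= iota L N} -> exists t,
  size A * size U + size [seq u <- U | ~~ translate t u] * W <= size U * W.
Proof.
move=> sU; have [W0|W_gt0] := posnP W.
  exists 0; rewrite W0 !muln0 addn0; case: U sU => [|u U] sU; first by rewrite muln0.
  by have := sU u (mem_head _ _); rewrite mem_iota -/W W0 ltn0 andbF.
apply: contrapT => none.
have lt_t t : count (translate t) U * W < size A * size U.
  rewrite ltnNge; apply/negP => le; apply: none; exists t.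
  rewrite size_filter -(count_predC (translate t) U) (mulnDl (count _ _)).
  by rewrite leq_add2r count_predC.
have lt_sum r : (\sum_(t <- r) count (translate t) U) * W + size r
    <= size r * (size A * size U).
  elim: r => [|t r ih]; first by rewrite big_nil.
  rewrite big_cons /= mulnDl mulSn; move: (lt_t t) ih.
  move: (_ * W) (_ * W) (size r * _) => x y z; move: (_ * _)%N (size r) => v w; clear; lia.
have := lt_sum (iota 0 W); have := sum_translates sU; rewrite size_iota.
move: (\sum_(t <- _) _) (size A * size U) W_gt0 => x y; move: W => w w0 xy; nia.
Qed.

(* Choosing each translate best possible divides the number of uncovered points
   by at least 1 / (1 - n / W), and (1 - n / W)^k <= W / (W + k n) where
   n = size A and W = L + N. *)
Lemma greedy_translates k : exists T : seq nat, size T = k /\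
  exists U : seq nat, [/\ {subset U <= iota L N},
    size U * (W + k * size A) <= N * W &
    forall u, u \in iota L N -> u \notin U -> exists2 t, t \in T & translate t u].
Proof.
elim: k => [|k [T [sT [U [sU leU cU]]]]].
  exists [::]; split=> //; exists (iota L N); split=> //.
    by rewrite mul0n addn0 size_iota.
  by move=> u ->.
have [t tU] := one_translate sU.
exists (t :: T); split; first by rewrite /= sT.
exists [seq u <- U | ~~ translate t u]; split.
- by move=> u; rewrite mem_filter => /andP[_ /sU].
- set u' := size [seq _ <- _ | _] in tU *; set u := size U in leU tU; set n := size A in leU tU *.
  have [W0|W_gt0] := posnP W.
    move: tU leU; rewrite W0 !muln0 addn0 leqn0 muln_eq0 => /orP[] /eqP n0 leU.
      by move: n0; rewrite /n => ->; rewrite !muln0.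
    have : u' <= u by rewrite /u' size_filter count_size.
    by rewrite n0 leqn0 => /eqP ->.
  (* This reduces to (W - n) (W + (k + 1) n) <= W (W + k n), the difference of the two sides being
     (k + 1) n^2. *)
  rewrite -(leq_pmul2r W_gt0); move: leU tU; clear; move: u' u n W => u' u n w.
  move=> /(leq_mul (leqnn w)) leU /(leq_mul (leqnn (w + k.+1 * n))) tU; nia.
- move=> u uL; rewrite mem_filter negb_and negbK => /orP[tu|/cU].
    by exists t; rewrite ?mem_head.
  by move=> /(_ uL)[t' t'T ?]; exists t'; rewrite // inE t'T orbT.
Qed.

End GreedyTranslates.

(** * Refinements along finite sets of times for a single map *)

Section ConstantSequence.
Variables (X : Type) (f : X -> X) (m : nat) (C : nat -> set X).
Local Open Scope nat_scope.

(** Words are indexed by the times themselves rather than by positions in a sequence, so that lists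
    of times can be concatenated and translated. *)
Definition refinement_covered_by (P : seq nat) (k : nat) : Prop :=
  exists s : nat -> nat -> nat,
    (forall j p, j < k -> p \in P -> s j p < m) /\
    forall x, exists2 j, j < k & forall p, p \in P -> C (s j p) (iter p f x).

Lemma comp_seq_const k : comp_seq (fun=> f) k = iter k f.
Proof. by elim: k => //= k ->. Qed.

Lemma join_covered_by_refinement a n k :
  join_covered_by [set: X] (fun=> f) a m C n k <->
  refinement_covered_by (map a (iota 0 n)) k.
Proof.
split=> [[s [sm sc]]|[s [sm sc]]].
  pose i p := index p (map a (iota 0 n)).
  have iP p : p \in map a (iota 0 n) -> i p < n /\ a (i p) = p.
    move=> pP; have iln : i p < n by have := pP; rewrite -index_mem size_map size_iota.
    split=> //; have := nth_index 0 pP.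
    by rewrite (nth_map 0) ?size_iota// nth_iota.
  exists (fun j p => s j (i p)); split=> [j p jk /iP[iln _]|x]; first exact: sm.
  have [//|j jk Cj] := sc x; exists j => // p /iP[iln ap].
  by have := Cj _ iln; rewrite comp_seq_const ap.
have aP i : i < n -> a i \in map a (iota 0 n).
  by move=> iln; apply: map_f; rewrite mem_iota.
exists (fun j i => s j (a i)); split=> [j i jk /aP|x _]; first exact: sm.
by have [j jk Cj] := sc x; exists j => // i /aP/Cj; rewrite comp_seq_const.
Qed.

Lemma refinement_covered_by_sub P P' k : {subset P <= P'} ->
  refinement_covered_by P' k -> refinement_covered_by P k.
Proof.
move=> PP' [s [sm sc]]; exists s; split=> [j p jk /PP'|x]; first exact: sm.
by have [j jk Cj] := sc x; exists j => // p /PP'/Cj.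
Qed.

Lemma refinement_covered_by_cat P P' k k' : refinement_covered_by P k ->
  refinement_covered_by P' k' -> refinement_covered_by (P ++ P') (k * k').
Proof.
move=> [s [sm sc]] [s' [sm' sc']].
(* The pair (j, j') is coded by j k' + j'; a time in both lists is served by the first word. *)
exists (fun j p => if p \in P then s (j %/ k') p else s' (j %% k') p); split.
  move=> j p jk; have k'0 : 0 < k'.
    by apply: contraTT jk; rewrite -eqn0Ngt => /eqP ->; rewrite muln0.
  rewrite mem_cat; case: ifPn => [pP _|_ /= pP'].
    by apply: sm => //; rewrite ltn_divLR.
  by apply: sm' => //; rewrite ltn_mod.
move=> x; have [j jk Cj] := sc x; have [j' jk' Cj'] := sc' x.
have k'0 : 0 < k' by apply: leq_ltn_trans jk'.
exists (j * k' + j'); first by nia.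
move=> p; rewrite mem_cat; case: ifPn => [pP _|_ /= pP'].
  by rewrite divnMDl// divn_small// addn0; exact: Cj.
by rewrite modnMDl modn_small//; exact: Cj'.
Qed.

Lemma refinement_covered_by_nil : refinement_covered_by [::] 1.
Proof. by exists (fun _ _ => 0); split=> // x; exists 0. Qed.

Lemma refinement_covered_by_flatten (Ps : seq (seq nat)) k :
  (forall P, P \in Ps -> refinement_covered_by P k) ->
  refinement_covered_by (flatten Ps) (k ^ size Ps).
Proof.
elim: Ps => [|P Ps ih] cP; first exact: refinement_covered_by_nil.
rewrite expnS; apply: refinement_covered_by_cat; first by apply: cP; rewrite mem_head.
by apply: ih => Q QPs; apply: cP; rewrite inE QPs orbT.
Qed.

Lemma refinement_covered_by_translate t P k : refinement_covered_by P k ->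
  refinement_covered_by (map (addn t) P) k.
Proof.
move=> [s [sm sc]]; exists (fun j p => s j (p - t)); split.
  by move=> j _ jk /mapP[p pP ->]; rewrite addKn; exact: sm.
move=> x; have [j jk Cj] := sc (iter t f x); exists j => // _ /mapP[p pP ->].
by rewrite addKn addnC iterD; exact: Cj.
Qed.

(** Surjectivity enters here: each y is f^t x for some x, and what x does at time t + p is what y
    does at time p. *)
Lemma refinement_covered_by_untranslate t P k : (forall y, exists x, f x = y) ->
  refinement_covered_by (map (addn t) P) k -> refinement_covered_by P k.
Proof.
move=> fsurj [s [sm sc]].
have ftsurj y : exists x, iter t f x = y.
  elim: t y {sm sc} => [|t ih] y; first by exists y.
  by have [z <-] := fsurj y; have [x <-] := ih z; exists x.
exists (fun j p => s j (t + p)); split=> [j p jk pP|y].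
  by apply: sm => //; apply/mapP; exists p.
have [x <-] := ftsurj y; have [j jk Cj] := sc x; exists j => // p pP.
by rewrite -iterD (addnC p t); apply: Cj; apply/mapP; exists p.
Qed.

Hypothesis C_cover : forall x, exists2 j, j < m & C j x.

Lemma refinement_covered_by_size P : refinement_covered_by P (m ^ size P).
Proof.
elim: P => [|p P ih]; first exact: refinement_covered_by_nil.
rewrite expnS -cat1s; apply: refinement_covered_by_cat ih.
exists (fun j _ => j); split=> // x; have [j jm Cj] := C_cover (iter p f x).
by exists j => // q; rewrite inE => /eqP->.
Qed.

(** The k greedy translates of the first n times cost a factor M^k, with M the covering number along
    them, and each of the u missed times costs a factor m. *)
Lemma Njoin_id_le a n k N L : strict_incr a -> (forall i, i < n -> a i <= L) ->
  (forall y, exists x, f x = y) ->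
  exists u, u * (L + N + k * n) <= N * (L + N) /\
  Njoin [set: X] (fun=> f) id m C N <= Njoin [set: X] (fun=> f) a m C n ^ k * m ^ u.
Proof.
move=> a_incr aL fsurj; pose A := map a (iota 0 n).
have a_inj : injective a.
  by move=> i j aij; case: (ltngtP i j) => // /a_incr; rewrite aij ltnn.
have A_uniq : uniq A by rewrite map_inj_uniq ?iota_uniq.
have A_le x : x \in A -> x <= L by move=> /mapP[i]; rewrite mem_iota => /andP[_ /aL + ->].
have sizeA : size A = n by rewrite size_map size_iota.
have [T [sT [U [sU leU cU]]]] := greedy_translates N A_uniq A_le k.
exists (size U); split; first by rewrite sizeA in leU.
apply: Njoin_le; apply/join_covered_by_refinement; rewrite map_id.
(* The greedy translates cover a window that starts at L, so [0, N) is first moved there. *)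
apply: (refinement_covered_by_untranslate (t := L) fsurj).
rewrite -iotaDl addn0.
set M := Njoin _ _ _ _ _ _.
apply: (@refinement_covered_by_sub _ (flatten [seq map (addn t) A | t <- T] ++ U)).
  move=> u uL; rewrite mem_cat; case: (boolP (u \in U)) => [|uU]; first by rewrite orbT.
  have [t tT tu] := cU u uL uU; rewrite orbF.
  by apply/flattenP; exists (map (addn t) A) => //; exact: map_f.
apply: refinement_covered_by_cat; last exact: refinement_covered_by_size.
rewrite -sT -(size_map (fun t => map (addn t) A)); apply: refinement_covered_by_flatten.
move=> _ /mapP[t tT ->]; apply: refinement_covered_by_translate.
apply/join_covered_by_refinement; apply: (Njoin_min _).1.
by apply: join_covered_by_exists => // x _; exact: C_cover.
Qed.

End ConstantSequence.

(** * Linear growth of the logarithmic covering numbers along any sequence *)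

Section LinearGrowth.
Variables (R : realType) (X : Type) (f : X -> X) (m : nat) (C : nat -> set X).
Hypothesis C_cover : forall x, exists2 j, (j < m)%N & C j x.
Hypothesis f_surj : forall y, exists x, f x = y.
Hypothesis X_neq0 : [set: X] !=set0.

Let Nf a n := Njoin [set: X] (fun=> f) a m C n.

Lemma Njoin_const_gt0 a n : (0 < Nf a n)%N.
Proof.
apply: (join_covered_by_gt0 X_neq0); apply: (Njoin_min _).1.
by apply: join_covered_by_exists => // x _; exact: C_cover.
Qed.

Lemma Njoin_linear_growth (h : R) (a : nat -> nat) : 0 < h ->
  (forall n0, exists2 n, (n0 <= n)%N & h * n%:R <= ln (Nf id n)%:R) ->
  strict_incr a ->
  exists2 c : R, 0 < c & forall n, c * n%:R <= ln (Nf a n)%:R.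
Proof.
move=> h_gt0 id_growth a_incr.
have m_gt0 : (0 < m)%N by have [x _] := X_neq0; have [j] := C_cover x; case: m.
(* With this q, at most 2 N / q missed times contribute no more than h N / 2. *)
have [q [q_gt0 hq]] : exists q : nat, 0 < q%:R :> R /\ 4 * ln m%:R <= h * q%:R :> R.
  exists (Num.trunc (4 * ln m%:R / h)).+1; split; first by rewrite ltr0n.
  by rewrite [leRHS]mulrC -ler_pdivrMr// ltW// truncnS_gt.
(* The constant results from h N <= 2 k log M and k n <= (q + 1) N. *)
exists (h / (2 * (q%:R + 1))) => [|n].
  by rewrite divr_gt0// mulr_gt0// addr_gt0.
have lnM0 : 0 <= ln (Nf a n)%:R :> R by rewrite ln_ge0// ler1n Njoin_const_gt0.
have [->|n_gt0] := posnP n; first by rewrite mulr0 ln_ge0// ler1n Njoin_const_gt0.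
(* The growth is known only for arbitrarily large N, so N may be taken beyond n and a n. Then q N +
   n <= (q + 1) N and a n + N <= 2 N. *)
have [N Ngt hN] := id_growth (maxn 1 (maxn n (a n))).
have [N1 nN aN] : [/\ (0 < N)%N, (n <= N)%N & (a n <= N)%N].
  by move: Ngt; rewrite !geq_max => /and3P[].
(* Chosen so that q N <= k n <= (q + 1) N. *)
pose k := (q * N %/ n).+1.
have kn1 : (q * N <= k * n)%N by rewrite ltnW// /k ltn_ceil.
have kn2 : (k * n <= q.+1 * N)%N.
  by rewrite /k mulSn mulSn leq_add// leq_divM.
have aL i : (i < n)%N -> (a i <= a n)%N by move/a_incr/ltnW.
have [u [ule Nle]] := Njoin_id_le C_cover k N a_incr aL f_surj.
(* From u q N <= u k n <= N (a n + N) <= 2 N^2. *)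
have uq : (u * q <= 2 * N)%N.
  rewrite -(leq_pmul2r N1) -mulnA; apply: leq_trans (_ : N * (a n + N) <= _)%N.
    by apply: leq_trans ule; rewrite leq_mul2l (leq_trans kn1)// ?leq_addl// orbT.
  by rewrite mulnC leq_mul2r; apply/orP; right; rewrite mul2n -addnn leq_add2r.
have lnle : h * N%:R <= k%:R * ln (Nf a n)%:R + u%:R * ln m%:R.
  apply: (le_trans hN).
  rewrite !mulr_natl -!lnXn ?ltr0n ?Njoin_const_gt0// -!natrX.
  rewrite -lnM ?posrE ?ltr0n ?expn_gt0 ?Njoin_const_gt0 ?m_gt0//.
  by rewrite -natrM ler_ln ?posrE ?ltr0n ?muln_gt0 ?expn_gt0 ?Njoin_const_gt0 ?m_gt0// ler_nat.
have lnm0 : 0 <= ln m%:R :> R by rewrite ln_ge0// ler1n.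
move: kn2 uq; rewrite -!(ler_nat R) !natrM -natr1 => kn2 uq.
have NR : 0 < N%:R :> R by rewrite ltr0n.
have nR : 0 < n%:R :> R by rewrite ltr0n.
rewrite mulrAC ler_pdivrMr ?mulr_gt0 ?addr_gt0//.
move: (ln _) (ln m%:R) lnM0 lnle lnm0 hq => M l M0 lnle l0 hq.
(* The term u log m is at most h N / 2 and is absorbed into the left side. *)
have e1 : h * N%:R <= 2 * (k%:R * M).
  rewrite -(ler_pM2r q_gt0).
  have : u%:R * q%:R * l <= 2 * N%:R * l by rewrite ler_wpM2r.
  have : h * N%:R * q%:R <= (k%:R * M + u%:R * l) * q%:R by rewrite ler_pM2r.
  have : N%:R * (4 * l) <= N%:R * (h * q%:R) by rewrite ler_pM2l.
  lra.
rewrite -(ler_pM2r NR).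
have : h * N%:R * n%:R <= 2 * (k%:R * M) * n%:R by rewrite ler_pM2r.
have : k%:R * n%:R * M <= (q%:R + 1) * N%:R * M by rewrite ler_wpM2r.
lra.
Qed.

End LinearGrowth.

(** * Criteria for positive and for zero sequence entropy *)

Section EntropyBounds.
Variables (R : realType) (S : Type) (Y : set S) (opn : set S -> Prop).
Variables (g : nat -> S -> S) (a : nat -> nat).

Lemma le_entropyA m C (c : R) : open_cover Y opn m C ->
  (forall n, c * n%:R <= ln (Njoin Y g a m C n)%:R) -> (c%:E <= entropyA R Y opn g a)%E.
Proof.
move=> mC cN; apply: (@le_trans _ _
    (limn_esup (fun n => ((ln (Njoin Y g a m C n)%:R) / n%:R)%:E))).
  apply: (@le_limn_esup _ _ _ 1) => n n1.
  by rewrite lee_fin ler_pdivlMr// ltr0n.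
by apply: ereal_sup_ubound; exists m, C.
Qed.

(** A positive supremum yields one cover with positive upper limit. Any h below that limit is a
    lower exponent for arbitrarily large n, though not for all n. *)
Lemma entropyA_gt0 : (0 < entropyA R Y opn g a)%E ->
  exists m C, open_cover Y opn m C /\ exists2 h : R, 0 < h &
    forall n0, exists2 n, (n0 <= n)%N & h * n%:R <= ln (Njoin Y g a m C n)%:R.
Proof.
move=> /ereal_sup_gt[_ [m [C [mC ->]]] l_gt0]; exists m, C; split=> //.
set u := (X in limn_esup X) in l_gt0.
have [h h_gt0 hl] : exists2 h : R, 0 < h & (h%:E < limn_esup u)%E.
  case: (limn_esup u) l_gt0 => [r| |]//; last by exists 1; rewrite ?ltry.
  by rewrite lte_fin => r0; exists (r / 2); rewrite ?lte_fin; lra.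
exists h => // n0; apply: contrapT => none.
suff : (limn_esup u <= h%:E)%E by rewrite leNgt hl.
apply: (@limn_esup_le _ _ _ n0.+1) => n n0n; rewrite lee_fin leNgt; apply/negP.
rewrite ltr_pdivlMr; last by rewrite ltr0n (leq_trans _ n0n).
by move=> lt; apply: none; exists n; [exact: ltnW|exact: ltW].
Qed.

(** The covering numbers stay below the one at [i0], and a bounded logarithm divided by n tends to
    0. *)
Lemma entropyA_eq0 : opn Y -> Y !=set0 -> (forall i x, Y x -> Y (comp_seq g (a i) x)) ->
  (forall m C, open_cover Y opn m C -> exists i0 j0, (j0 < m)%N /\
     forall i x, (i0 <= i)%N -> Y x -> C j0 (comp_seq g (a i) x)) ->
  entropyA R Y opn g a = 0%E.
Proof.
move=> oY Y0 gY tail; apply/eqP; rewrite eq_le; apply/andP; split.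
  apply: ge_ereal_sup => _ [m [C [[oC Ccov] ->]]].
  have [i0 [j0 [j0m Ctail]]] := tail m C (conj oC Ccov).
  set K := Njoin Y g a m C i0.
  have NK n : (Njoin Y g a m C n <= K)%N by exact: (@Njoin_tail_le _ _ _ _ _ _ _ j0).
  have N0 n : (0 < Njoin Y g a m C n)%N.
    apply: (join_covered_by_gt0 Y0); apply: (Njoin_min _).1.
    exact: join_covered_by_exists.
  apply/lee_addgt0Pr => e e0; rewrite add0e.
  apply: (@limn_esup_le _ _ _ (Num.trunc (ln K%:R / e)).+1) => n ltn.
  have n0 : 0 < n%:R :> R by rewrite ltr0n (leq_trans _ ltn).
  rewrite lee_fin ler_pdivrMr// (@le_trans _ _ (ln K%:R))//.
    by rewrite ler_ln ?posrE ?ltr0n// ?ler_nat// (leq_trans (N0 0)).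
  rewrite [leRHS]mulrC -ler_pdivrMr// ltW// (lt_le_trans (truncnS_gt _))// ler_nat//.
(* The cover by [Y] alone shows that the supremum is not negative. *)
have oc : open_cover Y opn 1 (fun=> Y) by split=> // x Yx; exists 0%N.
apply: (le_entropyA oc) => n; rewrite mul0r ln_ge0// ler1n.
apply: (join_covered_by_gt0 Y0); apply: (Njoin_min _).1.
exact: join_covered_by_exists oc.2 gY.
Qed.

End EntropyBounds.

(** * Borel probability measures and their images *)

Section BorelMeasures.
Variables (R : realType) (T : ptopologicalType).

Lemma borel_open (U : set T) : open U -> measurable (U : set (borel T)).
Proof. by move=> oU; exact: sub_sigma_algebra. Qed.

Lemma borel_preimage (f : T -> T) (B : set (borel T)) :
  continuous f -> measurable B -> measurable (f @^-1` B : set (borel T)).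
Proof.
move=> /continuousP cf mB.
have mf : measurable_fun [set: borel T] (f : borel T -> borel T).
  have e : @measurable _ (borel T) = <<s @open T >> by [].
  apply: (@measurability _ _ (borel T) (borel T) setT f (@open T) e).
  move=> _ [U oU <-].
  by rewrite setTI; apply: borel_open; exact: cf.
by rewrite -[X in measurable X]setTI; exact: mf.
Qed.

Lemma within_continuous_measurable (K : set T) (g : T -> R) :
  measurable (K : set (borel T)) -> {within K, continuous g} ->
  measurable_fun (K : set (borel T)) (g : borel T -> R).
Proof.
move=> mK /continuousP cg; apply: (measurability _ (RGenOpens.measurableE R)).
move=> _ [_ [a [b ->] <-]].
have oI : open `]a, b[%classic by exact: interval_open.
have /open_subspaceP[V oV VK] := cg _ oI.
have -> : K `&` g @^-1` `]a, b[ = V `&` K by rewrite VK setIC.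
by apply: measurableI => //; exact: borel_open.
Qed.

(** [MK] asks for the value 0 on non-Borel sets, which the set function of a probability need not
    take there. *)
Definition borel_normalized (mu : set (borel T) -> \bar R) : set (borel T) -> \bar R :=
  fun B => if `[< measurable B >] then mu B else 0%E.

Lemma borel_normalizedE mu (B : set (borel T)) :
  measurable B -> borel_normalized mu B = mu B.
Proof. by move=> mB; rewrite /borel_normalized asboolT. Qed.

Lemma MK_borel_normalized (K : set T) (P : probability (borel T) R) :
  measurable (K : set (borel T)) -> P K = 1%E -> MK K (borel_normalized P).
Proof.
move=> mK PK; split; first by exists P => B mB; rewrite borel_normalizedE.
by split=> [B nB|]; [rewrite /borel_normalized asboolF|rewrite borel_normalizedE].
Qed.

(** As [K] has full mass, the intersection with [K] inside [push] changes nothing, and [push] is the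
    law of [f]. *)
Lemma MK_push (K : set T) (f : T -> T) nu : measurable (K : set (borel T)) ->
  continuous f -> (forall x, K x -> K (f x)) -> MK K nu -> @MK R _ K (push K f nu).
Proof.
move=> mK cf fK [[P Pnu] [nu0 nuK]].
have mf : measurable_fun [set: borel T] (f : borel T -> borel T).
  by move=> _ B mB; rewrite setTI; exact: borel_preimage.
pose f0 : borel T -> borel T := f.
pose f0M := isMeasurableFun.Build _ _ (borel T) (borel T) f0 mf.
pose f' : {mfun borel T >-> borel T} := HB.pack f0 f0M.
have PK : P K = 1%E by rewrite Pnu.
have PKI (A : set (borel T)) : measurable A -> P (K `&` A) = P A.
  move=> mA; have PCK : P (A `\` K) = 0%E.
    apply/eqP; rewrite eq_le measure_ge0 andbT.
    have -> : 0%E = P (~` K) by rewrite probability_setC// PK subee.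
    by apply: le_measure; rewrite ?inE; [exact: measurableD|exact: measurableC|by move=> x []].
  rewrite -[in RHS](setUIDK A K) measureU; last 1 first.
  - by apply/seteqP; split=> // x [[_ ?] [_]].
  - by rewrite [X in (_ + X)%E](_ : _ = 0%E) ?adde0 1?setIC; last exact: PCK.
  - exact: measurableI.
  - exact: measurableD.
have -> : push K f nu = borel_normalized (distribution P f').
  apply/funext => B; rewrite /push /borel_normalized; case: asboolP => // mB.
  rewrite -Pnu ?PKI//; first exact: borel_preimage.
  by apply: measurableI => //; exact: borel_preimage.
apply: MK_borel_normalized => //.
rewrite /distribution /pushforward; apply: (eq_trans (esym (PKI _ _))).
  exact: borel_preimage.
by rewrite -PK; congr (P _); apply/seteqP; split=> [x []//|x Kx]; split=> //; exact: fK.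
Qed.

Lemma weak_open_MK (K : set T) : @weak_open R T K (MK K).
Proof. by split=> // nu _; exists 0%N, (fun=> cst 0), 1; split=> //; split. Qed.

End BorelMeasures.

(** * Convex combinations of Dirac measures *)

Section PointMixtures.
Variables (R : realType) (T : ptopologicalType) (k : nat) (w : nat -> R).
Hypotheses (w_ge0 : forall l, 0 <= w l) (w_sum : \sum_(l < k) w l = 1).

Definition mixture (x : nat -> T) : set (borel T) -> \bar R :=
  borel_normalized (fun B => \sum_(l < k) (w l)%:E * \d_(x l : borel T) B)%E.

(** The measure is a finite sum of scaled Dirac measures; for nonnegative functions the integral is
    additive over such a sum without any integrability condition. *)
Lemma mixture_probability (x : nat -> T) : exists P : probability (borel T) R,
  (forall B, P B = \sum_(l < k) (w l)%:E * \d_(x l : borel T) B)%E /\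
  forall g : T -> R, (forall x, 0 <= g x) ->
    measurable_fun [set: borel T] (g : borel T -> R) ->
    (\int[P]_(x in [set: borel T]) (g x)%:E = (\sum_(l < k) w l * g (x l))%:E)%E.
Proof.
pose mu : nat -> {measure set (borel T) -> \bar R} :=
  fun l => mscale (NngNum (w_ge0 l)) (\d_(x l : borel T)).
have muE B : msum mu k B = (\sum_(l < k) (w l)%:E * \d_(x l : borel T) B)%E by [].
have mu1 : msum mu k [set: borel T] = 1%E.
  rewrite muE (eq_bigr (fun l : 'I_k => (w l)%:E)).
    by rewrite sumEFin w_sum.
  by move=> l _; rewrite diracT mule1.
pose muM := Measure_isProbability.Build _ (borel T) R (msum mu k) mu1.
pose P : probability (borel T) R := HB.pack (msum mu k) muM.
exists P; split=> // g g0 mg.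
have mg' : measurable_fun [set: borel T] (EFin \o (g : borel T -> R)).
  exact/measurable_EFinP.
have -> : (\int[P]_(x in [set: borel T]) (g x)%:E =
    \int[msum mu k]_(x in [set: borel T]) (g x)%:E)%E by [].
rewrite ge0_integral_measure_sum//; last by move=> y _; rewrite lee_fin.
rewrite -sumEFin; apply: eq_bigr => l _.
rewrite ge0_integral_mscale//; last by move=> y _; rewrite lee_fin.
by rewrite integral_dirac// diracT mul1e.
Qed.

Lemma mixture_MK x : MK [set: T] (mixture x).
Proof.
have [P [PE _]] := mixture_probability x.
rewrite (_ : mixture x = borel_normalized P); last first.
  by rewrite /mixture; congr borel_normalized; apply/funext => B; rewrite PE.
by apply: MK_borel_normalized; rewrite ?probability_setT.
Qed.

Lemma push_mixture (f : T -> T) x : continuous f ->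
  push [set: T] f (mixture x) = mixture (f \o x).
Proof.
move=> cf; apply/funext => B; rewrite /push /mixture /borel_normalized.
case: asboolP => // mB; rewrite setTI asboolT; last exact: borel_preimage.
by apply: eq_bigr => l _; rewrite !diracE.
Qed.

Lemma comp_seq_push_mixture (f : T -> T) x n : continuous f ->
  comp_seq (fun=> push [set: T] f) n (mixture x) = mixture (iter n f \o x).
Proof. by move=> cf; elim: n => //= n ->; rewrite push_mixture. Qed.

End PointMixtures.

(** * Weakly open covers defined by finitely many integrals *)

Section IntegralNeighborhoods.
Variables (R : realType) (T : ptopologicalType) (M : nat) (g : nat -> T -> R).
Hypothesis g_cont : forall i, (i < M)%N -> continuous (g i).
Hypothesis g_01 : forall i x, 0 <= g i x <= 1.

Local Notation I P i := (\int[P]_(x in [set: borel T]) (g i x)%:E)%E.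

(** Integrals depend only on the values on Borel sets, so it is immaterial which [P] represents
    [nu]. *)
Definition near_integrals (c : nat -> R) (r : R) : set (set (borel T) -> \bar R) :=
  [set nu | MK [set: T] nu /\ exists2 P : probability (borel T) R,
    (forall B, measurable B -> P B = nu B) &
    forall i, (i < M)%N -> `|fine (I P i) - c i| < r].

Lemma integral_01 (P : probability (borel T) R) i : (i < M)%N ->
  I P i = (fine (I P i))%:E /\ 0 <= fine (I P i) <= 1.
Proof.
move=> iM; have mg : measurable_fun [set: borel T] (EFin \o (g i : borel T -> R)).
  apply/measurable_EFinP; apply: within_continuous_measurable => //.
  exact/continuous_subspaceT/g_cont.
have I0 : (0 <= I P i)%E.
  by apply: integral_ge0 => x _; rewrite lee_fin; case/andP: (g_01 i x).
have I1 : (I P i <= 1)%E.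
  rewrite -(probability_setT P) -[leRHS]mul1e -(integral_cst P measurableT).
  apply: ge0_le_integral => //= x _; rewrite lee_fin; by case/andP: (g_01 i x).
have If : I P i = (fine (I P i))%:E.
  by rewrite fineK// ge0_fin_numE// (le_lt_trans I1)// ltry.
by split=> //; rewrite -!lee_fin -If I0.
Qed.

Lemma near_integrals_open c r : weak_open [set: T] (near_integrals c r).
Proof.
split=> [nu []//|nu [nuM [P Pnu Pc]]].
(* Finitely many strict inequalities leave a common margin [e]. *)
have [e e0 eP] : exists2 e, 0 < e &
    forall i, (i < M)%N -> `|fine (I P i) - c i| + e <= r.
  elim: M Pc => [|N ih] Pc; first by exists 1.
  have [|e e0 eP] := ih; first by move=> i /ltnW; exact: Pc.
  exists (Num.min e (r - `|fine (I P N) - c N|)).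
    by rewrite lt_min e0 subr_gt0 Pc.
  move=> i; rewrite ltnS leq_eqVlt => /orP[/eqP->|/eP le]; rewrite addrC -lerBrDr.
    by rewrite ge_min lexx orbT.
  by rewrite ge_min lerBrDr addrC le.
exists M, g, e; split=> //; split=> [i iM|nu' nu'M nu'P].
  exact/continuous_subspaceT/g_cont.
split=> //; have [[P' P'nu'] _] := nu'M; exists P' => // i iM.
have := nu'P P P' Pnu P'nu' i iM.
have [-> _] := integral_01 P iM; have [-> _] := integral_01 P' iM.
rewrite -EFinB abse_EFin lte_fin /= => lt.
rewrite (lt_le_trans _ (eP i iM))// [ltRHS]addrC.
rewrite -[X in `|X|](subrKA (fine (I P i))).
by rewrite (le_lt_trans (ler_normD _ _))// ltrD2r.
Qed.

(** The vector of integrals lies in [0, 1]^M. The members are the open cubes of radius 1 / Q around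
    the points of the grid of mesh 1 / Q. *)
Lemma near_integrals_cover (Q : nat) : (0 < Q)%N ->
  exists m C, open_cover (MK [set: T]) (@weak_open R T [set: T]) m C /\
  forall j nu nu' (P P' : probability (borel T) R), (j < m)%N ->
    C j nu -> C j nu' ->
    (forall B, measurable B -> P B = nu B) ->
    (forall B, measurable B -> P' B = nu' B) ->
    forall i, (i < M)%N -> `|fine (I P i) - fine (I P' i)| < 2 / Q%:R.
Proof.
move=> Q0; have QR : 0 < Q%:R :> R by rewrite ltr0n.
(* There are Q + 1 grid values per coordinate because an integral may equal 1. *)
pose F := {ffun 'I_M -> 'I_Q.+1}.
pose c (phi : F) i : R := if insub i is Some j then (phi j : nat)%:R / Q%:R else 0.
pose C j := if insub j is Some jj then
  near_integrals (c (enum_val (jj : 'I_#|F|))) (Q%:R^-1) else set0.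
exists #|F|, C; split; [split|].
- by move=> j jF; rewrite /C insubT; exact: near_integrals_open.
- move=> nu nuM; have [[P Pnu] _] := nuM.
  have phiP (i : 'I_M) : exists j : 'I_Q.+1, `|fine (I P i) - (j : nat)%:R / Q%:R| < Q%:R^-1.
    have [_ /andP[I0 I1]] := integral_01 P (ltn_ord i).
    have IQ0 : 0 <= fine (I P i) * Q%:R by rewrite mulr_ge0.
    have lt : (Num.trunc (fine (I P i) * Q%:R) < Q.+1)%N.
      rewrite ltnS -(ler_nat R); apply: (@le_trans _ _ (fine (I P i) * Q%:R)).
        by rewrite truncn_le.
      by rewrite ler_piMl.
    exists (Ordinal lt) => /=; rewrite ger0_norm; last first.
      by rewrite subr_ge0 ler_pdivrMr// truncn_le.
    by rewrite ltrBlDl -[X in _ + X]mul1r -mulrDl natr1 ltr_pdivlMr// truncnS_gt.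
  have /choice[phi phiQ] := phiP.
  exists (enum_rank (finfun phi : F)) => //.
  rewrite /C valK; split=> //; exists P => // i iM.
  rewrite /c (insubT (fun j => j < M)%N iM) enum_rankK ffunE.
  exact: (phiQ (Ordinal iM)).
- move=> j nu nu' P P' jF; rewrite /C insubT.
  move=> [_ [P1 P1nu P1c]] [_ [P2 P2nu P2c]] Pnu P'nu' i iM.
  have -> : I P i = I P1 i.
    by apply: eq_measure_integral => A mA _; exact: etrans (Pnu _ mA) (esym (P1nu _ mA)).
  have -> : I P' i = I P2 i.
    by apply: eq_measure_integral => A mA _; exact: etrans (P'nu' _ mA) (esym (P2nu _ mA)).
  move: (P1c i iM) (P2c i iM); rewrite [X in _ -> X < _ -> _]distrC.
  move=> l1 l2; rewrite -(subrKA (c (enum_val (Sub j jF : 'I_#|F|)) i)).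
  by rewrite (le_lt_trans (ler_normD _ _))// mulr_natl mulr2n ltrD.
Qed.

End IntegralNeighborhoods.

(** * Invariant sets, and functions subordinate to an open cover *)

Lemma comp_seq_stable (S : Type) (Y : set S) (g : nat -> S -> S) :
  (forall n x, Y x -> Y (g n x)) -> forall n x, Y x -> Y (comp_seq g n x).
Proof. by move=> gY; elim=> //= n ih x /ih; exact: gY. Qed.

(** Complete regularity gives at each x a function that is 0 at x and 1 off a member containing x.
    By compactness finitely many of the sets where these are below 1 / 2 cover the space. *)
Lemma Urysohn_subordinate (R : realType) (X : pseudoPMetricType R) m (C : nat -> set X) :
  compact [set: X] -> open_cover [set: X] (rel_open [set: X]) m C ->
  exists (M : nat) (g : nat -> X -> R) (c : nat -> nat),
    [/\ forall i, continuous (g i), forall i x, 0 <= g i x <= 1,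
        forall i x, g i x != 0 -> (c i < m)%N /\ C (c i) x &
        forall x, exists2 i, (i < M)%N & g i x = 1].
Proof.
move=> cX [oC covC].
have /choice[jh jhP] : forall x, exists jh : nat * (X -> R),
    [/\ (jh.1 < m)%N, continuous jh.2, forall y, 0 <= jh.2 y <= 1, jh.2 x = 0 &
        forall y, ~ C jh.1 y -> jh.2 y = 1].
  move=> x; have [//|j jm Cjx] := covC x.
  have oCj : open (C j) by have [V oV ->] := oC j jm; rewrite setTI.
  have /(@uniform_separatorP _ R)[h [hc h01 h0 h1]] :=
    @uniform_completely_regular R X x (~` C j) (open_closedC oCj) (fun n => n Cjx).
  exists (j, h); split=> //= [y||y nCy].
  - by have := h01 (h y) (imageT _ _); rewrite /= in_itv.
  - by apply: h0; exists x.
  - by apply: h1; exists y.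
pose U x := [set y | (jh x).2 y < 1 / 2].
have oU x : open (U x).
  have [_ /continuousP hc _ _ _] := jhP x.
  have -> : U x = (jh x).2 @^-1` `]-oo, (1/2)[.
    by apply/seteqP; split=> y; rewrite /= in_itv.
  by apply: hc; exact: interval_open.
have : cover_compact [set: X] by rewrite -compact_cover.
move=> /(_ X setT U)[//||D _ covD].
  by move=> x _; exists x => //; have [_ _ _ h0 _] := jhP x; rewrite /U /= h0; lra.
(* Equal to 1 where the separating function is at most 1 / 2, and to 0 where it is 1, hence off the
   chosen member. *)
pose G x y := Num.min 1 (2 - 2 * (jh x).2 y).
pose s : seq X := finmap.enum_fset D.
(* Beyond the list [nth] returns [point], so subordination holds for every index. *)
exists (size s), (fun i => G (nth point s i)), (fun i => (jh (nth point s i)).1).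
split=> [i|i x|i x|x].
- have [_ hc _ _ _] := jhP (nth point s i) => y.
  apply: (@continuous_min _ _ (cst 1) (fun y => 2 - 2 * (jh (nth point s i)).2 y)).
    exact: cst_continuous.
  apply: cvgB; first exact: cvg_cst.
  by apply: cvgM; [exact: cvg_cst|exact: hc].
- have [_ _ /(_ x)/andP[h0 h1] _ _] := jhP (nth point s i).
  rewrite /G ge_min lexx /= andbT le_min ler01 /=; lra.
- have [jm _ _ _ h1] := jhP (nth point s i) => Gx; split=> //.
  apply: contrapT => /h1 h; move: Gx; rewrite /G h mulr1 subrr min_r ?eqxx//.
- have [y yD Uy] := covD x Logic.I.
  exists (index y s); first by rewrite index_mem.
  by rewrite nth_index// /G min_l//; move: Uy; rewrite /U /=; lra.
Qed.

(** * Separating mixtures of orbits by integrals *)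

Section MixtureSeparation.
Variables (R : realType) (X : pseudoPMetricType R) (f : X -> X).
Hypothesis f_cont : continuous f.
Variables (a : nat -> nat) (m : nat) (C : nat -> set X).
Variables (M : nat) (g : nat -> X -> R) (c : nat -> nat).
Hypotheses (g_cont : forall i, continuous (g i)) (g_01 : forall i x, 0 <= g i x <= 1).
Hypothesis g_sub : forall i x, g i x != 0 -> (c i < m)%N /\ C (c i) x.
Hypothesis g_cover : forall x, exists2 i, (i < M)%N & g i x = 1.

(** Since the functions take values in [0, 1], a difference of 1 means that one value is 0 and the
    other is 1. *)
Definition separated n (x y : X) := exists i l, [/\ (i < n)%N, (l < M)%N &
  `|g l (iter (a i) f x) - g l (iter (a i) f y)| = 1].

Lemma separated_sym n x y : separated n x y -> separated n y x.
Proof. by move=> [i [l [il lM d]]]; exists i, l; rewrite distrC. Qed.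

(** Points are added one at a time. To each point belongs the word of the members whose functions
    equal 1 along its orbit; a point not separated from it has nonzero values there and lies in the
    same member of the refinement. Were no further point separated from the first q, these q words
    would cover the space, against q < [Njoin]. *)
Lemma separated_family n q : (q <= Njoin [set: X] (fun=> f) a m C n)%N ->
  exists p : nat -> X, forall u v, (u < q)%N -> (v < q)%N -> u != v ->
    separated n (p u) (p v).
Proof.
elim: q => [|q ih] qN; first by exists (fun=> point).
have [p psep] := ih (ltnW qN).
have /choice[l lP] : forall ei : nat * nat, exists l,
    (l < M)%N /\ g l (iter (a ei.2) f (p ei.1)) = 1.
  by move=> [e i]; have [l] := g_cover (iter (a i) f (p e)); exists l.
have [x xP] : exists x, forall e, (e < q)%N -> separated n (p e) x.
  apply: contrapT => none; move: qN; rewrite ltnNge => /negP; apply.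
  apply: Njoin_le; exists (fun e i => c (l (e, i))); split=> [e i _ _|x _].
    have [_ l1] := lP (e, i); have [|//] := @g_sub (l (e, i)) (iter (a i) f (p e)).
    by rewrite l1 oner_neq0.
  apply: contrapT => nx; apply: none; exists x => e eq.
  apply: contrapT => nsep; apply: nx; exists e => // i il.
  rewrite comp_seq_const; apply: contrapT => nC; apply: nsep.
  have [lM l1] := lP (e, i); exists i, (l (e, i)); split=> //; rewrite l1.
  have [->|/g_sub[]//] := eqVneq (g (l (e, i)) (iter (a i) f x)) 0.
  by rewrite subr0 normr1.
exists (fun j => if j == q then x else p j) => u v.
rewrite (ltnS u) (ltnS v) (leq_eqVlt u) (leq_eqVlt v).
have [->|uq] := eqVneq u q; have [->|vq] := eqVneq v q.
- by rewrite ?eqxx.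
- by move=> _ /= vltq _; apply: separated_sym; exact: xP.
- by move=> /= ultq _ _; exact: xP.
- by move=> /= ultq vltq; exact: psep.
Qed.

Lemma sum_expr2 k : \sum_(l < k) 2 ^+ l = 2 ^+ k - 1 :> R.
Proof.
elim: k => [|k ih]; first by rewrite big_ord0 expr0 subrr.
by rewrite big_ord_recr /= ih exprS; lra.
Qed.

(** The term at [l] has size 2^l, and the terms below it add up to at most 2^l - 1. *)
Lemma binary_sum_ge1 (d : nat -> R) l k : (l < k)%N -> `|d l| = 1 ->
  (forall i, `|d i| <= 1) -> (forall i, (l < i)%N -> (i < k)%N -> d i = 0) ->
  1 <= `|\sum_(i < k) 2 ^+ i * d i|.
Proof.
move=> lk dl1 d1 d0; rewrite -(big_mkord xpredT (fun i => 2 ^+ i * d i)).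
rewrite (big_cat_nat (leq0n _) lk)//= [X in _ + X]big_nat [X in _ + X]big1 ?addr0; last first.
  by move=> i /andP[li ik]; rewrite d0 ?mulr0.
rewrite big_nat_recr//= big_mkord addrC.
have le : `|\sum_(i < l) 2 ^+ i * d i| <= 2 ^+ l - 1.
  rewrite -sum_expr2 (le_trans (ler_norm_sum _ _ _))// ler_sum// => i _.
  by rewrite normrM ger0_norm ?exprn_ge0// ler_piMr// exprn_ge0.
rewrite (le_trans _ (lerB_normD _ _))// normrM dl1 mulr1 ger0_norm ?exprn_ge0//.
lra.
Qed.

(** Each word of k + 1 separated points gives one mixture. The cover is fixed before n, as the
    entropy requires. *)
Lemma Njoin_push_ge k : exists m' C',
  open_cover (@MK R X [set: X]) (@weak_open R X [set: X]) m' C' /\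
  forall n, (Njoin [set: X] (fun=> f) a m C n ^ k.+1 <=
    Njoin (@MK R X [set: X]) (fun=> push [set: X] f) a m' C' n)%N.
Proof.
have g_cont' i : (i < M)%N -> continuous (g i) by [].
(* Two measures in one member have integrals less than 2^-(k + 1) apart, whereas mixtures of
   distinct words will differ by at least 1 / (2^(k + 1) - 1). *)
have [m' [C' [covC' C'P]]] := near_integrals_cover g_cont' g_01 (expn_gt0 2 k.+2).
exists m', C'; split=> // n; set q := Njoin _ _ _ _ _ _.
have [p psep] := separated_family (leqnn q).
pose w (l : nat) : R := 2 ^+ l / (2 ^+ k.+1 - 1).
have W_gt0 : 0 < 2 ^+ k.+1 - 1 :> R.
  by rewrite subr_gt0 exprn_egt1 // ltr1n.
have w_ge0 l : 0 <= w l by rewrite divr_ge0 ?exprn_ge0// ltW.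
have w_sum : \sum_(l < k.+1) w l = 1.
  by rewrite -mulr_suml sum_expr2 divff// gt_eqF.
pose I := {ffun 'I_k.+1 -> 'I_q}.
pose x (phi : I) (l : nat) : X := p (phi (inord l)).
have <- : #|I| = (q ^ k.+1)%N by rewrite card_ffun !card_ord.
apply: (@card_le_join_covered_by _ (@MK R X [set: X]) (fun=> push [set: X] f) a m' C'
   I (fun phi => mixture k.+1 w (x phi)) n).
- by move=> phi; exact: mixture_MK.
- move=> phi psi neq.
  have [l0 l0P] : exists l, phi l != psi l.
    apply: contrapT => none; move/eqP: neq; apply; apply/ffunP => l.
    by apply/eqP/negPn/negP => ne; apply: none; exists l.
  (* The largest position where the words differ carries the dominating weight; the time and the
     function that separate its two points are used. *)
  have [l lP lmax] :=
    @arg_maxnP _ l0 (fun l => phi l != psi l) (fun l => l : nat) l0P.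
  have [i [s [il sM dist1]]] := psep (phi l) (psi l) (ltn_ord _) (ltn_ord _) lP.
  exists i => // j jm' []; rewrite !comp_seq_push_mixture// => Cphi Cpsi.
  pose y phi (l : nat) := iter (a i) f (x phi l).
  have mgs : measurable_fun [set: borel X] (g s : borel X -> R).
    by apply: within_continuous_measurable => //; exact/continuous_subspaceT.
  have gs0 z : 0 <= g s z by case/andP: (g_01 s z).
  have [P [PE /(_ _ gs0 mgs) IP]] := mixture_probability w_ge0 w_sum (y phi).
  have [Q [QE /(_ _ gs0 mgs) IQ]] := mixture_probability w_ge0 w_sum (y psi).
  have := C'P j _ _ P Q jm' Cphi Cpsi.
  move=> /(_ _ _ s sM); rewrite IP IQ /= => lt.
  have {lt} := lt (fun B mB => etrans (PE B) (esym (borel_normalizedE _ mB)))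
    (fun B mB => etrans (QE B) (esym (borel_normalizedE _ mB))).
  rewrite -sumrB.
  pose d (i : nat) := g s (y phi i) - g s (y psi i).
  rewrite (eq_bigr (fun i : 'I_k.+1 => 2 ^+ i * d i / (2 ^+ k.+1 - 1))); last first.
    by move=> l' _; rewrite -mulrBr /w mulrAC.
  rewrite -mulr_suml normrM [X in _ * X]ger0_norm ?invr_ge0 ?ltW//.
  have d1 i' : `|d i'| <= 1.
    have := g_01 s (y phi i'); have := g_01 s (y psi i').
    by rewrite /d ler_norml; lra.
  have dl : `|d l| = 1 by rewrite /d /y /x inord_val.
  have d0 (i' : nat) : (l < i')%N -> (i' < k.+1)%N -> d i' = 0.
    move=> li' i'k; rewrite /d /y /x.
    have [->|ne] := eqVneq (phi (inord i')) (psi (inord i')); first by rewrite subrr.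
    by have := lmax _ ne; rewrite /geq /= inordK// leqNgt li'.
  have ge1 := binary_sum_ge1 (ltn_ord l) dl d1 d0.
  apply/negP.
  rewrite -leNgt natrX ler_pdivrMr ?exprn_gt0// -mulrA.
  have W_le : 2 <= (2 ^+ k.+1 - 1)^-1 * 2 ^+ k.+2 :> R.
    by rewrite mulrC ler_pdivlMr// [leRHS]exprS ler_pM2l// gerBl.
  by rewrite (le_trans W_le)// ler_peMl// (le_trans _ W_le).
- apply: (Njoin_min _).1; apply: join_covered_by_exists; first by case: covC'.
  move=> i; apply: comp_seq_stable => _ nu; exact: MK_push.
Qed.

End MixtureSeparation.

(** * Sequence entropy of a surjective map and of its induced map *)

Lemma constant_sequence_entropy (R : realType) (X : pseudoPMetricType R) (f : X -> X)
    (a : nat -> nat) : compact [set: X] -> continuous f ->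
  (forall y, exists x, f x = y) -> strict_incr a ->
  (0 < entropyA R [set: X] (rel_open [set: X]) (fun=> f) id)%E ->
  (0 < entropyA R [set: X] (rel_open [set: X]) (fun=> f) a)%E /\
  entropyA R (@MK R X [set: X]) (@weak_open R X [set: X]) (fun=> push [set: X] f) a
    = +oo%E.
Proof.
move=> cX f_cont f_surj a_incr /entropyA_gt0[m [C [mC [h h_gt0 hC]]]].
have C_cover x : exists2 j, (j < m)%N & C j x by apply: mC.2.
have X_neq0 : [set: X] !=set0 by exists point.
have [c c_gt0 cN] := Njoin_linear_growth C_cover f_surj X_neq0 h_gt0 hC a_incr.
split; first by apply: (lt_le_trans _ (le_entropyA mC cN)); rewrite lte_fin.
have [M [g [b [g_cont g_01 g_sub g_cover]]]] := Urysohn_subordinate cX mC.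
apply/eqyP => A A_gt0.
(* Mixtures of k + 1 > A / c points give an exponent (k + 1) c >= A. *)
have [m' [C' [covC' NC']]] :=
  Njoin_push_ge f_cont a g_cont g_01 g_sub g_cover (Num.trunc (A / c)).
apply: (le_trans _ (le_entropyA covC' (c := (Num.trunc (A / c)).+1%:R * c) _)).
  by rewrite lee_fin -ler_pdivrMr// ltW// truncnS_gt.
move=> n; rewrite -mulrA.
have N0 : (0 < Njoin [set: X] (fun=> f) a m C n)%N by exact: Njoin_const_gt0.
apply: (@le_trans _ _ ((Num.trunc (A / c)).+1%:R * ln (Njoin [set: X] (fun=> f) a m C n)%:R)).
  by rewrite ler_pM2l.
rewrite mulr_natl -lnXn ?ltr0n// -natrX ler_ln ?posrE ?ltr0n ?expn_gt0 ?N0//.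
  by rewrite ler_nat.
by apply: leq_trans (NC' n); rewrite expn_gt0 N0.
Qed.

(** * Measures concentrated near a point *)

Section ConcentratedMeasures.
Variables (R : realType) (T : ptopologicalType) (K : set T).
Hypotheses (K_compact : compact K) (K_measurable : measurable (K : set (borel T))).

(** [D] carries all the mass, so the integral over [K] is one over [D]. Compactness of [K] bounds
    [g] and makes it integrable. *)
Lemma integral_concentrated (P : probability (borel T) R) (D : set T) (g : T -> R) (c e : R) :
  measurable (D : set (borel T)) -> D `<=` K -> P D = 1%E -> {within K, continuous g} ->
  (forall x, D x -> `|g x - c| <= e) ->
  exists2 r, (\int[P]_(x in K) (g x)%:E = r%:E)%E & `|r - c| <= e.
Proof.
move=> mD DK PD cg gc.
have mg : measurable_fun (K : set (borel T)) (g : borel T -> R).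
  exact: within_continuous_measurable.
have bg : [bounded (g : borel T -> R) x | x in (K : set (borel T))].
  have : bounded_set (g @` K) by apply/compact_bounded/continuous_compact.
  move=> [M [Mr MP]]; exists M; split=> // x Mx y Ky.
  by apply: (MP x Mx); exists y.
have fin (A : set (borel T)) : measurable A -> (P A < +oo)%E.
  by move=> mA; rewrite (le_lt_trans (probability_le1 P mA))// ltry.
have ig : P.-integrable (K : set (borel T)) (EFin \o g).
  exact: measurable_bounded_integrable (fin _ _) _ _.
have igD : P.-integrable (D : set (borel T)) (EFin \o g).
  exact: integrableS ig.
have icD : P.-integrable (D : set (borel T)) (cst c%:E).
  exact/finite_measure_integrable_cst.
have -> : (\int[P]_(x in K) (g x)%:E = \int[P]_(x in D) (g x)%:E)%E.
  rewrite (@negligible_integral _ _ _ P K (K `\` D))//; last 2 first.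
  - exact: measurableD.
  - apply/eqP; rewrite eq_le measure_ge0 andbT.
    have -> : 0%E = P (~` D) by rewrite probability_setC// PD subee.
    apply: le_measure; rewrite ?inE; [exact: measurableD|exact: measurableC|by move=> x []].
  by rewrite setDD setIC setIidl.
have fi : (\int[P]_(x in D) (g x)%:E \is a fin_num)%E by exact: integrable_fin_num igD.
exists (fine (\int[P]_(x in D) (g x)%:E)%E); first by rewrite fineK.
rewrite -lee_fin -abse_EFin EFinB fineK//.
have -> : c%:E = (\int[P]_(x in D) cst c%:E x)%E by rewrite integral_cst//= PD mule1.
rewrite -integralB//; apply: le_trans (le_abse_integral _ _ _) _ => //.
  by apply: emeasurable_funB => //; apply/measurable_EFinP; exact: measurable_funS mg.
rewrite -[e%:E]mule1 -PD -integral_cst//; apply: ge0_le_integral => //.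
  apply: measurableT_comp => //; apply: emeasurable_funB => //.
  by apply/measurable_EFinP; exact: measurable_funS mg.
Qed.

Lemma dirac_MK (x0 : T) : K x0 -> MK K (borel_normalized (\d_(x0 : borel T) : _ -> \bar R)).
Proof.
by move=> Kx0; apply: MK_borel_normalized => //; rewrite /= diracE mem_set.
Qed.

Lemma within_continuous_common_nbhd (n : nat) (gs : nat -> T -> R) (e : R) (x0 : T) :
  0 < e -> K x0 -> (forall i, (i < n)%N -> {within K, continuous (gs i)}) ->
  exists V, [/\ open V, V x0 & forall i x, (i < n)%N -> K x -> V x ->
    `|gs i x - gs i x0| < e].
Proof.
move=> e0 Kx0; elim: n => [|n ih] cgs.
  by exists setT; split=> //; exact: openT.
have [|V [oV Vx0 VP]] := ih; first by move=> i /ltnW; exact: cgs.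
have /subspace_continuousP/(_ x0 Kx0)/cvgrPdist_lt/(_ e e0) := cgs n (ltnSn n).
rewrite /within /= nbhsE => -[W [oW Wx0] WP].
exists (V `&` W); split; [exact: openI|by []|move=> i x].
rewrite ltnS leq_eqVlt => /orP[/eqP->|il] Kx [Vx Wx]; last exact: VP.
by rewrite distrC; exact: WP.
Qed.

(** The finitely many test functions that define the neighbourhood of the Dirac measure are almost
    constant near [x0], so every measure living there has almost the same integrals. *)
Lemma weak_open_dirac_nbhd (U : set (set (borel T) -> \bar R)) (x0 : T) : K x0 ->
  weak_open K U -> U (borel_normalized (\d_(x0 : borel T) : _ -> \bar R)) ->
  exists V, [/\ open V, V x0 & forall nu (D : set T), MK K nu ->
    measurable (D : set (borel T)) -> D `<=` K `&` V -> nu D = 1%E -> U nu].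
Proof.
move=> Kx0 [_ oU] /oU[n [gs [e [e0 [cgs UP]]]]].
(* Half of [e], because the estimate of the integral is not strict. *)
have e2 : 0 < e / 2 by lra.
have [V [oV Vx0 VP]] := within_continuous_common_nbhd e2 Kx0 cgs.
exists V; split=> // nu D nuM mD DKV nuD; apply: UP => // P P' PE P'E i iln.
have DK : D `<=` K by move=> x /DKV[].
have P'D : P' D = 1%E by rewrite P'E.
have gsD x : D x -> `|gs i x - gs i x0| <= e / 2.
  by move=> Dx; apply/ltW/VP => //; case: (DKV x Dx).
have [r -> re] := integral_concentrated mD DK P'D (cgs i iln) gsD.
have -> : (\int[P]_(x in K) (gs i x)%:E = (gs i x0)%:E)%E.
  rewrite (@eq_measure_integral _ _ _ _ (\d_(x0 : borel T))); last first.
    by move=> A mA _; exact: etrans (PE A mA) (borel_normalizedE _ mA).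
  rewrite integral_dirac//; first by rewrite diracE mem_set// mul1e.
  by apply/measurable_EFinP; apply: within_continuous_measurable => //; exact: cgs.
by rewrite -EFinB abse_EFin lte_fin; lra.
Qed.

End ConcentratedMeasures.

(** * The alternating sequence of maps on the unit interval *)

Section ZeroSequenceEntropy.
Variable R : realType.

(** On [0, 1] the graph rises as 3 y up to 1 / 3, stays at 1 up to 2 / 3, and falls as 3 - 3 y: each
    outer third is mapped onto [0, 1]. *)
Definition trapezoid (y : R) : R := Num.max 0 (Num.min 1 (3 / 2 - 3 * `|y - 1 / 2|)).

(** For n = 2 i and for n = 2 i + 1 the factor is the same i + 1, so the odd map first undoes the
    contraction just made. *)
Definition squeezed_trapezoid (n : nat) (x : R) : R :=
  if odd n then trapezoid (n./2.+1%:R * x) else x / n./2.+1%:R.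

Local Notation fs := squeezed_trapezoid.

Lemma trapezoid_01 y : 0 <= trapezoid y <= 1.
Proof. by rewrite le_max lexx /= ge_max ler01 ge_min lexx. Qed.

Lemma trapezoid_continuous : continuous trapezoid.
Proof.
rewrite /trapezoid => y; apply: (@continuous_max R R (cst 0)
  (fun y => Num.min 1 (3 / 2 - 3 * `|y - 1 / 2|))); first exact: cst_continuous.
apply: (@continuous_min R R (cst 1) (fun y => 3 / 2 - 3 * `|y - 1 / 2|)).
  exact: cst_continuous.
apply: cvgB; first exact: cvg_cst.
apply: cvgM; first exact: cvg_cst.
by apply: cvg_norm; apply: cvgB; [exact: cvg_id|exact: cvg_cst].
Qed.

Lemma squeezed_trapezoid_continuous n : continuous (fs n).
Proof.
move=> x; rewrite /squeezed_trapezoid; case: (odd n).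
  apply: (@continuous_comp R R R (fun x => n./2.+1%:R * x) trapezoid).
    by apply: cvgM; [exact: cvg_cst|exact: cvg_id].
  exact: trapezoid_continuous.
by apply: cvgM; [exact: cvg_id|exact: cvg_cst].
Qed.

Lemma I01E (x : R) : I01 R x = (0 <= x <= 1) :> Prop.
Proof. by rewrite /I01 /= in_itv. Qed.

Lemma squeezed_even_le n x : I01 R x -> ~~ odd n -> 0 <= fs n x <= n./2.+1%:R^-1.
Proof.
rewrite I01E => /andP[x0 x1] nodd; rewrite /squeezed_trapezoid (negbTE nodd).
by rewrite divr_ge0//= -[leRHS]mul1r ler_pM2r// invr_gt0.
Qed.

Lemma squeezed_trapezoid_I01 n x : I01 R x -> I01 R (fs n x).
Proof.
move=> x01; case: (boolP (odd n)) => [nodd|/(squeezed_even_le x01)/andP[x0 x1]].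
  by rewrite I01E /squeezed_trapezoid nodd trapezoid_01.
by rewrite I01E x0 (le_trans x1)// invf_le1// ler1n.
Qed.

Lemma comp_seq_squeezed_double i x : comp_seq fs i.*2 x = iter i trapezoid x.
Proof.
elim: i => //= i ->; rewrite /squeezed_trapezoid /= odd_double /= uphalf_double doubleK.
by rewrite mulrC divfK.
Qed.

Lemma trapezoid_branches y : 0 <= y <= 1 ->
  trapezoid (y / 3) = y /\ trapezoid (1 - y / 3) = y.
Proof.
move=> /andP[y0 y1]; rewrite /trapezoid ler0_norm; last by lra.
rewrite ger0_norm; last by lra.
have -> : 3 / 2 - 3 * - (y / 3 - 1 / 2) = y by lra.
have -> : 3 / 2 - 3 * (1 - y / 3 - 1 / 2) = y by lra.
by rewrite min_r// max_r.
Qed.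

(** The point 0 is pulled back through r inverse branches, so that the iterate number i < r lies in
    the left or right third as [s i] prescribes. *)
Fixpoint itinerary_point (r : nat) (s : nat -> bool) : R :=
  if r is r'.+1 then
    let y := itinerary_point r' (fun i => s i.+1) in
    if s 0%N then 1 - y / 3 else y / 3
  else 0.

Lemma itinerary_point_01 r s : 0 <= itinerary_point r s <= 1.
Proof.
elim: r s => [|r ih] s /=; first by rewrite lexx ler01.
by have := ih (fun i => s i.+1); case: (s 0%N); lra.
Qed.

Lemma itinerary_pointP r s i : (i < r)%N ->
  if s i then 2 / 3 <= iter i trapezoid (itinerary_point r s)
  else iter i trapezoid (itinerary_point r s) <= 1 / 3.
Proof.
elim: i r s => [|i ih] [|r] s //= ir; have y01 := itinerary_point_01 r (fun i => s i.+1).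
  by case: (s 0%N); lra.
rewrite -iterS iterSr.
have -> : trapezoid (if s 0%N then 1 - itinerary_point r (fun i => s i.+1) / 3
    else itinerary_point r (fun i => s i.+1) / 3) = itinerary_point r (fun i => s i.+1).
  by have [e1 e2] := trapezoid_branches y01; case: (s 0%N).
exact: (ih r (fun i => s i.+1)).
Qed.

Lemma squeezed_trapezoid_entropy_gt0 :
  (0 < entropyA R (I01 R) (rel_open (I01 R)) fs id)%E.
Proof.
(* The two sets overlap in the middle third only, so the left and the right third share no
   member. *)
pose D (j : nat) : set R := if j == 0%N then [set x | x < 2 / 3] else [set x | 1 / 3 < x].
pose C (j : nat) : set R := I01 R `&` D j.
have covC : open_cover (I01 R) (rel_open (I01 R)) 2 C.
  split=> [j _|x Kx].
    exists (D j) => //; rewrite /D.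
    by case: ifP => _; [exact: open_lt|exact: open_gt].
  have [x23|x23] := ltP x (2 / 3); first by exists 0%N.
  by exists 1%N => //; split=> //; rewrite /D /=; lra.
have ln2 : 0 < ln 2 :> R by rewrite ln_gt0// ltr1n.
apply: (@lt_le_trans _ _ (ln 2 / 2)%:E); first by rewrite lte_fin; lra.
apply: (le_entropyA covC) => n.
(* There are [uphalf n] even times below n; using only these gives the exponent (ln 2) / 2. *)
pose I := {ffun 'I_(uphalf n) -> bool}.
pose s (phi : I) i := if insub i is Some j then phi j else false.
have cardI : #|I| = (2 ^ uphalf n)%N by rewrite card_ffun card_bool card_ord.
have le : (2 ^ uphalf n <= Njoin (I01 R) fs id 2 C n)%N.
  rewrite -cardI; apply: (@card_le_join_covered_by _ (I01 R) fs id 2 C I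
     (fun phi => itinerary_point (uphalf n) (s phi)) n).
  - by move=> phi; rewrite I01E itinerary_point_01.
  - move=> phi psi neq.
    have [l lP] : exists l, phi l != psi l.
      apply: contrapT => none; move/eqP: neq; apply; apply/ffunP => l.
      by apply/eqP/negPn/negP => ne; apply: none; exists l.
    exists l.*2; first by have := ltn_ord l; rewrite -ltn_double; lia.
    have sl (chi : I) : s chi l = chi l by rewrite /s valK.
    have := itinerary_pointP (s phi) (ltn_ord l).
    have := itinerary_pointP (s psi) (ltn_ord l).
    rewrite !sl => psiP phiP j j2; rewrite !comp_seq_squeezed_double.
    move: psiP phiP lP; case: (phi l); case: (psi l) => //= psiP phiP _ [[_ c1] [_ c2]];
      move: c1 c2; rewrite /D; case: j {j2} => [|j] /=; lra.
  - apply: (Njoin_min _).1; apply: join_covered_by_exists; first by case: covC.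
    by move=> i; apply: comp_seq_stable => k y; exact: squeezed_trapezoid_I01.
have N0 : (0 < Njoin (I01 R) fs id 2 C n)%N by apply: leq_trans le; rewrite expn_gt0.
apply: (@le_trans _ _ (ln (2 ^ uphalf n)%:R)); last first.
  by rewrite ler_ln ?posrE ?ltr0n ?expn_gt0// ler_nat.
rewrite natrX lnXn// -[leRHS]mulr_natr -mulrA ler_pM2l//.
rewrite mulrC ler_pdivrMr// -natrM ler_nat; lia.
Qed.

Lemma I01_measurable : measurable (I01 R : set (borel R)).
Proof.
rewrite -[X in measurable X]setCK; apply: measurableC; apply: borel_open.
by rewrite openC; exact: itv_closed.
Qed.

Lemma squeezed_interval_nbhd (V : set R) : open V -> V 0 ->
  exists i0, forall i x, (i0 <= i)%N -> 0 <= x <= i.+1%:R^-1 -> V x.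
Proof.
move=> oV V0; have : nbhs (0 : R) V by exact: open_nbhs_nbhs.
move=> /nbhs_ballP[e /= e0 eV]; exists (Num.trunc e^-1) => i x i0i /andP[x0 xi].
apply: eV; rewrite /ball /= sub0r normrN ger0_norm// (le_lt_trans xi)//.
rewrite invf_plt ?posrE// (lt_le_trans (truncnS_gt _))// ler_nat//.
Qed.

(** The last of the first 2 i + 1 maps is the contraction with index 2 i, whose image of [0, 1] lies
    in [0, 1 / (i + 1)]. *)
Let odd_times i := i.*2.+1.

Lemma squeezed_trapezoid_sequence_entropy :
  entropyA R (I01 R) (rel_open (I01 R)) fs odd_times = 0%E.
Proof.
have I0 : I01 R 0 by rewrite I01E lexx ler01.
apply: entropyA_eq0.
- by exists setT; [exact: openT|rewrite setIT].
- by exists 0.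
- by move=> i; apply: comp_seq_stable => k y; exact: squeezed_trapezoid_I01.
move=> m C [oC covC]; have [j0 j0m Cj0] := covC 0 I0.
have [V oV CV] := oC j0 j0m.
have V0 : V 0 by move: Cj0; rewrite CV => -[].
have [i0 i0V] := squeezed_interval_nbhd oV V0.
exists i0, j0; split=> // i x i0i Kx; rewrite CV.
have Kx' : I01 R (comp_seq fs i.*2 x).
  by apply: comp_seq_stable => // k y; exact: squeezed_trapezoid_I01.
split; first exact: squeezed_trapezoid_I01.
apply: (i0V i) => //.
by have := squeezed_even_le Kx' (negbT (odd_double i)); rewrite doubleK.
Qed.

(** The member of the cover that contains the Dirac measure at 0 eventually contains the images of
    all measures. *)
Lemma squeezed_trapezoid_push_sequence_entropy :
  entropyA R (@MK R R (I01 R)) (@weak_open R R (I01 R)) (fun n => push (I01 R) (fs n))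
    odd_times = 0%E.
Proof.
have I0 : I01 R 0 by rewrite I01E lexx ler01.
have mK := I01_measurable.
have cK : compact (I01 R) by exact: segment_compact.
have stable n nu : MK (I01 R) nu -> @MK R R (I01 R) (push (I01 R) (fs n) nu).
  apply: MK_push => //; first exact: squeezed_trapezoid_continuous.
  exact: squeezed_trapezoid_I01.
have d0M := @dirac_MK R R (I01 R) mK 0 I0.
apply: entropyA_eq0.
- exact: weak_open_MK.
- by exists (borel_normalized \d_(0 : borel R)).
- by move=> i; exact: comp_seq_stable.
move=> m C [oC covC]; have [j0 j0m Cj0] := covC _ d0M.
have [V [oV V0 VC]] := weak_open_dirac_nbhd cK mK I0 (oC j0 j0m) Cj0.
have [i0 i0V] := squeezed_interval_nbhd oV V0.
exists i0, j0; split=> // i nu i0i nuM.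
have nu'M := comp_seq_stable stable i.*2 nuM.
(* The measure at time 2 i + 1 gives full mass to this interval, which lies in [V] as soon as i >=
   [i0]. *)
pose D : set R := `[0, i.+1%:R^-1]%classic.
have mD : measurable (D : set (borel R)).
  rewrite -[X in measurable X]setCK; apply: measurableC; apply: borel_open.
  by rewrite openC; exact: itv_closed.
have DE x : D x = (0 <= x <= i.+1%:R^-1) :> Prop by rewrite /D /= in_itv.
apply: (VC _ D) => //.
- exact: stable.
- move=> x; rewrite DE => xD; split; last exact: i0V xD.
  by rewrite I01E; case/andP: xD => -> /le_trans -> //; rewrite invf_le1// ler1n.
rewrite /= /push asboolT//.
have -> : I01 R `&` fs i.*2 @^-1` D = I01 R.
  apply/seteqP; split=> [x []//|x Kx]; split=> //.
  rewrite /preimage /mkset DE.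
  by have := squeezed_even_le Kx (negbT (odd_double i)); rewrite doubleK.
by case: nu'M => _ [].
Qed.

End ZeroSequenceEntropy.

Theorem theorem5p6 :
  (* (i) *)
  (forall (R : realType) (X : pseudoPMetricType R),
     hausdorff_space X -> compact [set: X] ->
     forall f : X -> X, continuous f -> (forall y, exists x, f x = y) ->
     (0 < @entropyA R _ [set: X] (rel_open [set: X]) (fun _ => f) id)%E ->
     forall a : nat -> nat, strict_incr a ->
       (0 < @entropyA R _ [set: X] (rel_open [set: X]) (fun _ => f) a)%E /\
       @entropyA R _ (@MK R _ [set: X]) (@weak_open R _ [set: X])
         (fun _ => push [set: X] f) a = +oo%E)
  /\
  (* (ii) *)
  (forall R : realType,
     exists fs : nat -> R -> R,
       (forall n, {within (I01 R), continuous (fs n)} /\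
                  fs n @` (I01 R) `<=` (I01 R)) /\
       (0 < @entropyA R _ (I01 R) (rel_open (I01 R)) fs id)%E /\
       exists a : nat -> nat, strict_incr a /\
         @entropyA R _ (I01 R) (rel_open (I01 R)) fs a = 0%E /\
         @entropyA R _ (@MK R _ (I01 R)) (@weak_open R _ (I01 R))
           (fun n => push (I01 R) (fs n)) a = 0%E).
Proof.
split=> [R X _ cX f f_cont f_surj h_gt0 a a_incr|R].
  exact: constant_sequence_entropy.
exists (@squeezed_trapezoid R); split=> [n|].
  split; first exact/continuous_subspaceT/squeezed_trapezoid_continuous.
  by move=> _ [x Kx <-]; exact: squeezed_trapezoid_I01.
split; first exact: squeezed_trapezoid_entropy_gt0.
exists (fun i => i.*2.+1); split=> [i j ij|]; first by rewrite ltnS ltn_double.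
split; first exact: squeezed_trapezoid_sequence_entropy.
exact: squeezed_trapezoid_push_sequence_entropy.
Qed.
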